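(* Let $E$ be a topological real vector space, let $X \subseteq E$ be a real convex cone, and let $\preceq$ be a complete preorder on $X$. Let $X_0 = \{x \in X : x \sim tx \text{ for some positive real number } t \neq 1\}$, $X_+ = \{x \in X : x \prec tx \text{ for some real number } t > 1\}$ and $X_- = \{x \in X : tx \prec x \text{ for some real number } t > 1\}$. Assume that $X_0$ and $X_+$ are both nonempty, while $X_-$ is empty. Then the following conditions are equivalent: (1) There exists a nonnegative, sublinear and continuous order-preserving function $u : X \to \mathbb{R}$ for $\preceq$. (2) The following conditions are all satisfied: (a) $\preceq$ is homothetic; (b) $\preceq$ is continuous; (c) the set $\{q x_+ : q \in \mathbb{Q}^{++}\}$ is an order-dense subset of $(X_+, \preceq)$ for every element $x_+ \in X_+$; (d) $x \sim y$ for every $x, y \in X_0$; (e) $x \prec x_+$ for every $x \in X_0$, $x_+ \in X_+$; (f) $x + y \prec (q + r) x_+$ for every $x, y \in X$, $x_+ \in X_+$, $q, r \in \mathbb{Q}^{++}$ such that $x \prec q x_+$ and $y \prec r x_+$.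
   Context: $\mathbb{Q}^{++}$ and $\mathbb{R}^{++}$ denote the sets of positive rational and positive real numbers. A preorder $\preceq$ is a reflexive and transitive binary relation; $\prec$ denotes its strict part ($x \prec y$ iff $x \preceq y$ and not $y \preceq x$) and $\sim$ its symmetric part ($x \sim y$ iff $x \preceq y$ and $y \preceq x$). It is complete if for any $x, y$ either $x \preceq y$ or $y \preceq x$. A subset $X$ of a real vector space is a real convex cone if $tx \in X$ for all $x \in X$, $t \in \mathbb{R}^{++}$, and $x + y \in X$ for all $x, y \in X$ (the zero vector need not belong to $X$). $X$ carries the topology $\tau_X$ induced by the vector topology of $E$; continuity of functions and openness of subsets of $X$ refer to $\tau_X$. A function $u : X \to \mathbb{R}$ is order-preserving for $\preceq$ if $x \preceq y$ implies $u(x) \le u(y)$ and $x \prec y$ implies $u(x) < u(y)$, for all $x, y \in X$. It is sublinear if it is homogeneous of degree one ($u(tx) = t u(x)$ for all $x \in X$, $t \in \mathbb{R}^{++}$) and subadditive ($u(x + y) \le u(x) + u(y)$ for all $x, y \in X$). A complete preorder $\preceq$ on $X$ is homothetic if $x \preceq y$ entails $tx \preceq ty$ for all $x, y \in X$, $t \in \mathbb{R}^{++}$. It is continuous if $\{z \in X : z \prec x\}$ and $\{z \in X : x \prec z\}$ are open subsets of $X$ for every $x \in X$. Given a preordered set $(Y, \preceq)$, a subset $A$ of $Y$ is an order-dense subset of $(Y, \preceq)$ if for every $x, y \in Y$ with $x \prec y$ there exists $a \in A$ such that $x \prec a \prec y$. $(X_+, \preceq)$ denotes $X_+$ with the restriction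 of $\preceq$. *)

(* Defs.v *)
From mathcomp Require Import all_boot all_order all_algebra.
From mathcomp Require Import all_classical all_reals all_analysis.

Set Implicit Arguments.
Unset Strict Implicit.
Unset Printing Implicit Defensive.

Import Order.TTheory GRing.Theory Num.Theory.
Import numFieldNormedType.Exports.

Local Open Scope classical_set_scope.
Local Open Scope ring_scope.

(* A preorder on a subset X of E, and a function on X, are represented by a
   relation [le : rel E] and a function [u : E -> R] on the whole of E. All
   conditions below are relativized to X, so that the values of [le] and [u]
   outside X are irrelevant. *)

Section Preorder.
Context {E : Type}.
Implicit Types (X Y A : set E) (le : rel E).

Definition complete_preorder_on X le : Prop :=
  [/\ {in X, reflexive le}, {in X & &, transitive le} & {in X &, total le}].

Definition strict_part le : rel E := fun x y => le x y && ~~ le y x.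

Definition symmetric_part le : rel E := fun x y => le x y && le y x.

Definition order_dense_subset Y le A : Prop :=
  A `<=` Y /\
  {in Y &, forall x y, strict_part le x y ->
    exists a, [/\ A a, strict_part le x a & strict_part le a y]}.

Definition order_preserving_on {R : realType} X le (u : E -> R) : Prop :=
  {in X &, forall x y, (le x y -> u x <= u y) /\
                       (strict_part le x y -> u x < u y)}.

End Preorder.

Section Cone.
Context {R : realType} {E : lmodType R}.
Implicit Types (X : set E) (le : rel E).

Definition convex_cone X : Prop :=
  {in X, forall x (t : R), 0 < t -> X (t *: x)} /\
  {in X &, forall x y, X (x + y)}.

Definition sublinear_on X (u : E -> R) : Prop :=
  {in X, forall x (t : R), 0 < t -> u (t *: x) = t * u x} /\
  {in X &, forall x y, u (x + y) <= u x + u y}.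

Definition homothetic_on X le : Prop :=
  {in X &, forall x y (t : R), 0 < t -> le x y -> le (t *: x) (t *: y)}.

Definition X0 X le : set E :=
  [set x | X x /\
    exists t : R, [/\ 0 < t, t != 1 & symmetric_part le x (t *: x)]].

Definition Xplus X le : set E :=
  [set x | X x /\ exists t : R, 1 < t /\ strict_part le x (t *: x)].

Definition Xminus X le : set E :=
  [set x | X x /\ exists t : R, 1 < t /\ strict_part le (t *: x) x].

Definition rational_multiples (x : E) : set E :=
  [set ratr q *: x | q in [set q : rat | 0 < q]].

End Cone.

(* [subspace X] is E with the topology in which the points outside X are
   isolated; a subset of X is open in it iff it is relatively open in X. *)
Definition continuous_preorder_on {E : topologicalType} (X : set E)
    (le : rel E) : Prop :=
  {in X, forall x,
    open ([set z | X z /\ strict_part le z x] : set (subspace X)) /\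
    open ([set z | X z /\ strict_part le x z] : set (subspace X))}.

(* Main.v *)
(* An order-preserving [u] satisfies [x <= y <-> u x <= u y], so that X0 and X+
   are the sets where [u = 0] and [u > 0], and all the conditions can be read
   off [u].  Conversely, fix [p] in X+ and put
   [u x = inf {t > 0 | x < t p}], a Minkowski gauge of the order: density of
   the rational multiples of [p] makes [u] finite, positive on X+ and strictly
   increasing, and the condition on sums is subadditivity tested on rational
   thresholds. *)
Require Import Defs.
From mathcomp Require Import all_boot all_order all_algebra.
From mathcomp Require Import all_classical all_reals all_analysis.

Set Implicit Arguments.
Unset Strict Implicit.
Unset Printing Implicit Defensive.

Import Order.TTheory GRing.Theory Num.Theory.
Import numFieldNormedType.Exports.

Local Open Scope classical_set_scope.
Local Open Scope ring_scope.

(** If [b < a], a rational strictly between them would contradict the hypothesis. Through this,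
    bounds on the gauge need only be tested at rational thresholds. *)
Lemma le_ratr_gt (R : realType) (a b : R) :
  (forall q : rat, b < ratr q -> a <= ratr q) -> a <= b.
Proof.
move=> h; rewrite leNgt; apply/negP => /rat_in_itvoo[q].
by rewrite in_itv/= => /andP[/h aq]; rewrite ltNge aq.
Qed.

Lemma strict_partE {T : Type} (X : set T) (le : rel T) x y :
  complete_preorder_on X le -> X x -> X y -> strict_part le x y = ~~ le y x.
Proof.
case=> _ _ tot Xx Xy; rewrite /strict_part.
by have := tot x y (mem_set Xx) (mem_set Xy); case: (le x y); case: (le y x).
Qed.

(** * Complete preorders represented by a real function *)

Section Representation.
Context {R : realType} {T : Type} (X : set T) (le : rel T) (u : T -> R).
Hypothesis pre : complete_preorder_on X le.

(** Completeness supplies the converse implication: when [le x y] fails, [y] is strictly below [x],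
    so [u y < u x]. *)
Lemma order_preserving_ler x y : order_preserving_on X le u ->
  X x -> X y -> le x y = (u x <= u y).
Proof.
move=> u_op Xx Xy; apply/idP/idP.
  exact: (u_op _ _ (mem_set Xx) (mem_set Xy)).1.
apply: contraTT; rewrite -(strict_partE pre)// -ltNge.
by case: (u_op _ _ (mem_set Xy) (mem_set Xx)).
Qed.

Lemma order_preserving_ltr x y : order_preserving_on X le u ->
  X x -> X y -> strict_part le x y = (u x < u y).
Proof.
by move=> u_op Xx Xy; rewrite (strict_partE pre)// order_preserving_ler// ltNge.
Qed.

End Representation.

Lemma order_preserving_continuous_preorder {R : realType} {E : topologicalType}
    (X : set E) (le : rel E) (u : E -> R) :
  complete_preorder_on X le -> order_preserving_on X le u ->
  {within X, continuous u} -> continuous_preorder_on X le.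
Proof.
move=> pre u_op /continuousP u_cont x /set_mem Xx.
have rayE (A : set R) (P : set E) : open A ->
    (forall z, X z -> P z <-> A (u z)) ->
    open ([set z | X z /\ P z] : set (subspace X)).
  (* Points outside [X] are isolated in [subspace X], so cutting a set down to [X] does not affect
     its openness there. *)
  move=> oA PA; suff -> : [set z | X z /\ P z] = u @^-1` A `&` X.
    by rewrite open_subspaceIT; exact: u_cont.
  by apply/seteqP; split=> z [? ?]; split => //; apply/(PA z).
split.
- by apply: (rayE _ _ (@open_lt _ (u x))) => z Xz;
  rewrite (order_preserving_ltr pre u_op).
- by apply: (rayE _ _ (@open_gt _ (u x))) => z Xz;
  rewrite (order_preserving_ltr pre u_op).
Qed.

(* Every ray of values of [u] is cut out by a ray of [le]: the thresholds
   [a > 0] are attained on the half-line through [p], the threshold [0] at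
   [z], and the negative ones are trivial. *)
Lemma order_preserving_continuous {R : realType} {E : topologicalLmodType R}
    (X : set E) (le : rel E) (u : E -> R) (z p : E) :
  convex_cone X -> complete_preorder_on X le -> continuous_preorder_on X le ->
  {in X, forall x, 0 <= u x} -> sublinear_on X u ->
  order_preserving_on X le u ->
  X z -> u z = 0 -> X p -> 0 < u p -> {within X, continuous u}.
Proof.
move=> [coneZ _] pre le_cont u_ge0 [uZ _] u_op Xz uz0 Xp up0.
have attained a : 0 < a -> exists2 y, X y & u y = a.
  move=> a0; have t0 : 0 < a / u p by rewrite divr_gt0.
  exists ((a / u p) *: p); first exact: coneZ (mem_set Xp) _ t0.
  by rewrite uZ ?mem_set// divfK// gt_eqF.
have open_below a : 0 < a -> open ([set x | X x /\ u x < a] : set (subspace X)).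
  move=> /attained[y Xy <-].
  suff -> : [set x | X x /\ u x < u y] = [set x | X x /\ strict_part le x y].
    by case: (le_cont y (mem_set Xy)).
  by apply/seteqP; split=> x [Xx] /=; rewrite (order_preserving_ltr pre u_op).
have open_above a : open ([set x | X x /\ a < u x] : set (subspace X)).
  have [a0|a0] := ltP a 0.
    suff -> : [set x | X x /\ a < u x] = X by exact: open_subspaceT.
    apply/seteqP; split=> x /=; first by case.
    by move=> Xx; split=> //; rewrite (lt_le_trans a0)// u_ge0// mem_set.
  have [y Xy <-] : exists2 y, X y & u y = a.
    by move: a0; rewrite le_eqVlt => /predU1P[<-|/attained//]; exists z.
  suff -> : [set x | X x /\ u y < u x] = [set x | X x /\ strict_part le y x].
    by case: (le_cont y (mem_set Xy)).
  by apply/seteqP; split=> x [Xx] /=; rewrite (order_preserving_ltr pre u_op).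
rewrite continuous_subspace_in => x /set_mem Xx.
apply/cvgrPdist_lt => e e0.
(* Nonnegativity of [u] makes the upper threshold positive, as [open_below] requires. *)
have ue0 : 0 < u x + e by rewrite ltr_wpDl// u_ge0// mem_set.
have nbhs_below : nbhs (x : subspace X) [set y | X y /\ u y < u x + e].
  by apply: open_nbhs_nbhs; split; [exact: open_below|rewrite /= ltrDl].
have nbhs_above : nbhs (x : subspace X) [set y | X y /\ u x - e < u y].
  by apply: open_nbhs_nbhs; split; [exact: open_above|rewrite /= ltrBlDr ltrDl].
apply: filterS2 nbhs_below nbhs_above => y [_ y_lt] [_ y_gt] /=.
by rewrite distrC ltr_distl y_gt y_lt.
Qed.

(** Under homotheticity, x < t p means x / t < p, so this is the Minkowski functional of the lower
    section of [p]. *)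
Definition gauge {R : realType} {E : lmodType R} (le : rel E) (p x : E) : R :=
  inf [set t | 0 < t /\ strict_part le x (t *: p)].

(** * The order under positive dilations *)

Section Gauge.
Context {R : realType} {E : lmodType R} (X : set E) (le : rel E).
Hypothesis cone : convex_cone X.
Hypothesis pre : complete_preorder_on X le.
Hypothesis homo : homothetic_on X le.
Hypothesis Xminus0 : Xminus X le = set0.
Hypothesis X0_Xplus : {in X0 X le & Xplus X le, forall x p, strict_part le x p}.

Local Notation "x <~ y" := (strict_part le x y) (at level 70).

Lemma cone_scale x (t : R) : X x -> 0 < t -> X (t *: x).
Proof. by move=> Xx; apply: cone.1 _ (mem_set Xx) t. Qed.

Lemma cone_add x y : X x -> X y -> X (x + y).
Proof. by move=> Xx Xy; apply: cone.2 _ _ (mem_set Xx) (mem_set Xy). Qed.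

Lemma preorder_trans y x z : X x -> X y -> X z -> le x y -> le y z -> le x z.
Proof.
case: pre => _ tr _ Xx Xy Xz.
exact: tr (mem_set Xy) (mem_set Xx) (mem_set Xz).
Qed.

Lemma strict_le_trans y x z : X x -> X y -> X z -> x <~ y -> le y z -> x <~ z.
Proof.
move=> Xx Xy Xz; rewrite !(strict_partE pre)// => + yz.
by apply: contra => zx; exact: (@preorder_trans z).
Qed.

Lemma strict_trans y x z : X x -> X y -> X z -> x <~ y -> y <~ z -> x <~ z.
Proof. by move=> Xx Xy Xz xy /andP[yz _]; exact: (@strict_le_trans y). Qed.

Lemma le_strict_trans y x z : X x -> X y -> X z -> le x y -> y <~ z -> x <~ z.
Proof.
move=> Xx Xy Xz; rewrite !(strict_partE pre)// => xy.
by apply: contra => zx; exact: (@preorder_trans x).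
Qed.

Lemma homothetic_scale x y (t : R) : X x -> X y -> 0 < t ->
  le (t *: x) (t *: y) = le x y.
Proof.
move=> Xx Xy t0; apply/idP/idP; last first.
  exact: (homo (mem_set Xx) (mem_set Xy)).
have Xtx := cone_scale Xx t0; have Xty := cone_scale Xy t0.
have := @homo _ _ (mem_set Xtx) (mem_set Xty) t^-1.
by rewrite !scalerA mulVf ?gt_eqF// !scale1r invr_gt0; apply.
Qed.

Lemma homothetic_strict_scale x y (t : R) : X x -> X y -> 0 < t ->
  (t *: x <~ t *: y) = (x <~ y).
Proof. by move=> Xx Xy t0; rewrite /strict_part !homothetic_scale. Qed.

(** Comparing [x] with the single multiple 2x decides the case, since 2x < x would put [x] in the
    empty set X-. *)
Lemma X0_or_Xplus x : X x -> X0 X le x \/ Xplus X le x.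
Proof.
move=> Xx; have X2x : X (2%:R *: x) by apply: cone_scale.
have [l1|l1] := boolP (le x (2%:R *: x)); last first.
  have : Xminus X le x.
    by split=> //; exists 2%:R; rewrite ltr1n (strict_partE pre).
  by rewrite Xminus0.
have [l2|l2] := boolP (le (2%:R *: x) x).
  left; split=> //; exists 2%:R.
  by rewrite /symmetric_part l1 l2 ltr0n (eqr_nat R 2 1).
by right; split=> //; exists 2%:R; rewrite ltr1n (strict_partE pre).
Qed.

Lemma X0_not_Xplus x : X0 X le x -> ~ Xplus X le x.
Proof.
move=> x0 xp; have := X0_Xplus (mem_set x0) (mem_set xp).
by rewrite /strict_part andbN.
Qed.

(** Membership in X+ provides only one dilation factor. Any other r > 1 works too: r x ~ x would
    place [x] in X0, and r x < x in X-. Homotheticity reduces the claim to r = t / s. *)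
Lemma Xplus_scale_lt x (s t : R) : Xplus X le x -> 0 < s -> s < t ->
  s *: x <~ t *: x.
Proof.
move=> xp s0 st; have Xx := xp.1; have t0 := lt_trans s0 st.
have r1 : 1 < t / s by rewrite ltr_pdivlMr// mul1r.
have r0 : 0 < t / s by rewrite divr_gt0.
have Xr := cone_scale Xx r0.
have -> : t *: x = s *: ((t / s) *: x) by rewrite scalerA mulrC divfK ?gt_eqF.
rewrite homothetic_strict_scale// (strict_partE pre)//; apply/negP => rx.
have [xr|xr] := boolP (le x ((t / s) *: x)).
  apply: X0_not_Xplus xp; split=> //.
  by exists (t / s); rewrite gt_eqF// /symmetric_part xr rx.
have : Xminus X le x by split=> //; exists (t / s); rewrite (strict_partE pre).
by rewrite Xminus0.
Qed.

Lemma Xplus_scale x (t : R) : Xplus X le x -> 0 < t -> Xplus X le (t *: x).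
Proof.
move=> xp t0; split; first exact: cone_scale xp.1 t0.
exists 2%:R; rewrite ltr1n scalerA; split=> //.
by apply: Xplus_scale_lt => //; rewrite ltr_pMl// ltr1n.
Qed.

(** * The gauge of a fixed element of X+ *)

Variables (p : E).
Hypothesis Xplus_p : Xplus X le p.
Hypothesis dense_p :
  order_dense_subset (Xplus X le) le (rational_multiples p).

Local Notation u := (gauge le p).

Let X_p : X p := Xplus_p.1.

Lemma rational_multiple_between x y : Xplus X le x -> Xplus X le y -> x <~ y ->
  exists q : rat, [/\ 0 < ratr q :> R, x <~ ratr q *: p & ratr q *: p <~ y].
Proof.
move=> xp yp /(dense_p.2 _ _ (mem_set xp) (mem_set yp))[_ [[q q0 <-] xq qy]].
by exists q; rewrite ltr0q.
Qed.

(** Ensures that the infimum defining the gauge is over a nonempty set. On X0 the element [p] itself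
    is above; on X+ density is applied between x and 2x. *)
Lemma multiple_above x : X x -> exists2 t : R, 0 < t & x <~ t *: p.
Proof.
move=> /X0_or_Xplus[x0|xp].
  by exists 1; rewrite ?scale1r//; apply: X0_Xplus; exact: mem_set.
have x2 : x <~ 2%:R *: x by rewrite -{1}[x]scale1r Xplus_scale_lt// ltr1n.
have [q [q0 xq _]] :=
  rational_multiple_between xp (Xplus_scale xp (ltr0n _ 2)) x2.
by exists (ratr q).
Qed.

Lemma gauge_has_lbound x :
  has_lbound [set t : R | 0 < t /\ strict_part le x (t *: p)].
Proof. by exists 0 => t [/ltW]. Qed.

Lemma gauge_le x (t : R) : 0 < t -> x <~ t *: p -> u x <= t.
Proof. by move=> t0 xt; apply: ge_inf => //; exact: gauge_has_lbound. Qed.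

Lemma gauge_ge x (t : R) : X x ->
  (forall s : R, 0 < s -> x <~ s *: p -> t <= s) -> t <= u x.
Proof.
move=> /multiple_above[s s0 xs] h; apply: lb_le_inf; first by exists s.
by move=> r [/h]; exact.
Qed.

Lemma gauge_ge0 x : X x -> 0 <= u x.
Proof. by move=> Xx; apply: gauge_ge => // s /ltW. Qed.

(** Some admissible r lies below t, and the positive multiples of [p] increase strictly, so the
    defining set is upward closed. *)
Lemma gauge_lt x (t : R) : X x -> u x < t -> x <~ t *: p.
Proof.
move=> Xx xt; have [s s0 xs] := multiple_above Xx.
have := inf_lt _ xt; case; first by exists s.
move=> r [r0 xr] rt; have t0 := lt_trans r0 rt.
apply: strict_trans xr _ => //; [exact: cone_scale|exact: cone_scale|].
exact: Xplus_scale_lt.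
Qed.

(** All positive multiples of [p] are in X+, hence above [x], so arbitrarily small thresholds are
    admissible. *)
Lemma gauge_X0 x : X0 X le x -> u x = 0.
Proof.
move=> x0; apply/le_anti; rewrite (gauge_ge0 x0.1) andbT.
apply: le_ratr_gt => q q0; apply: gauge_le => //.
by apply: X0_Xplus; apply: mem_set => //; exact: Xplus_scale.
Qed.

Lemma le_multiple_gauge x (t : R) : X x -> 0 < t -> le (t *: p) x -> t <= u x.
Proof.
move=> Xx t0 tx; apply: gauge_ge => // s s0 xs.
rewrite leNgt; apply/negP => /(Xplus_scale_lt Xplus_p s0).
have Xs := cone_scale X_p s0; have Xt := cone_scale X_p t0.
rewrite (strict_partE pre)//.
by case/andP: (le_strict_trans Xt Xx Xs tx xs) => ->.
Qed.

(** Density between x / 2 and x yields a positive rational multiple of [p] below [x], whose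
    coefficient bounds the gauge from below. *)
Lemma gauge_gt0 x : Xplus X le x -> 0 < u x.
Proof.
move=> xp; have Xx := xp.1.
have hx : 2%:R^-1 *: x <~ x.
  by rewrite -{2}[x]scale1r Xplus_scale_lt// ?invf_lt1 ?invr_gt0 ?ltr1n.
have hp : Xplus X le (2%:R^-1 *: x) by apply: Xplus_scale; rewrite ?invr_gt0.
have [q [q0 _ /andP[qx _]]] := rational_multiple_between hp xp hx.
exact: lt_le_trans q0 (le_multiple_gauge Xx q0 qx).
Qed.

Lemma gauge_scale_le x (t : R) : X x -> 0 < t -> u (t *: x) <= t * u x.
Proof.
move=> Xx t0; rewrite -ler_pdivrMl//.
apply: le_ratr_gt => q; set s := ratr q => us.
have s0 : 0 < s := le_lt_trans (gauge_ge0 Xx) us.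
rewrite ler_pdivrMl//; apply: gauge_le; first exact: mulr_gt0.
rewrite -scalerA homothetic_strict_scale//; last exact: cone_scale.
exact: gauge_lt.
Qed.

Lemma gauge_scale x (t : R) : X x -> 0 < t -> u (t *: x) = t * u x.
Proof.
move=> Xx t0; apply/eqP; rewrite eq_le gauge_scale_le//= -ler_pdivlMl//.
(* The reverse inequality is the same bound applied to [t *: x] and the inverse factor. *)
have := @gauge_scale_le (t *: x) t^-1 (cone_scale Xx t0).
by rewrite scalerA mulVf ?gt_eqF// scale1r invr_gt0; apply.
Qed.

Lemma gauge_subadditive x y : X x -> X y ->
  (forall q r : rat, 0 < q -> 0 < r -> x <~ ratr q *: p -> y <~ ratr r *: p ->
    x + y <~ ratr (q + r) *: p) ->
  u (x + y) <= u x + u y.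
Proof.
(* Each summand on the right is replaced in turn by a rational above it, the other one being moved
   across the inequality. *)
move=> Xx Xy h; rewrite -lerBlDr; apply: le_ratr_gt => q uq.
rewrite lerBlDr -lerBlDl; apply: le_ratr_gt => r ur; rewrite lerBlDl.
have q0 : 0 < q by rewrite -(ltr0q R) (le_lt_trans _ uq)// gauge_ge0.
have r0 : 0 < r by rewrite -(ltr0q R) (le_lt_trans _ ur)// gauge_ge0.
rewrite -rmorphD; apply: gauge_le; first by rewrite ltr0q addr_gt0.
by apply: h => //; exact: gauge_lt.
Qed.

Lemma gauge_order_preserving :
  {in X0 X le &, forall x y, symmetric_part le x y} ->
  order_preserving_on X le u.
Proof.
move=> X0_sim x y /set_mem Xx /set_mem Xy; split=> [xy|xy].
  apply: gauge_ge => // s s0 ys; apply: gauge_le => //.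
  by apply: le_strict_trans ys => //; exact: cone_scale.
(* Nothing is strictly below an element of X0: other elements of X0 are equivalent to it, and those
   of X+ are above it. *)
case: (X0_or_Xplus Xy) => [y0|yp].
  move: xy; rewrite (strict_partE pre)//; case: (X0_or_Xplus Xx) => [x0|xp].
    by case/andP: (X0_sim _ _ (mem_set y0) (mem_set x0)) => ->.
  by case/andP: (X0_Xplus (mem_set y0) (mem_set xp)) => ->.
case: (X0_or_Xplus Xx) => [x0|xp]; first by rewrite gauge_X0// gauge_gt0.
(* One rational between would only give u x <= q <= u y. A second one, with q p < r p < y, forces q
   < r and makes the inequality strict. *)
have [q [q0 xq qy]] := rational_multiple_between xp yp xy.
have qp := Xplus_scale Xplus_p q0.
have [r [r0 qr /andP[ry _]]] := rational_multiple_between qp yp qy.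
apply: le_lt_trans (gauge_le q0 xq) _.
apply: lt_le_trans (le_multiple_gauge Xy r0 ry).
rewrite ltNge; apply/negP; rewrite le_eqVlt => /predU1P[rq|rq].
  by move: qr; rewrite rq /strict_part andbN.
have := Xplus_scale_lt Xplus_p r0 rq; case/andP: qr => qr _.
by rewrite /strict_part qr andbF.
Qed.

End Gauge.

Theorem corollary3p2 (R : realType) (E : topologicalLmodType R)
    (X : set E) (le : rel E) :
  convex_cone X ->
  complete_preorder_on X le ->
  X0 X le !=set0 ->
  Xplus X le !=set0 ->
  Xminus X le = set0 ->
  (exists u : E -> R,
      [/\ {in X, forall x, 0 <= u x},
          sublinear_on X u,
          {within X, continuous u} &
          order_preserving_on X le u])
  <->
  [/\ homothetic_on X le,
      continuous_preorder_on X le,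
      {in Xplus X le, forall xp,
         order_dense_subset (Xplus X le) le (rational_multiples xp)},
      {in X0 X le &, forall x y, symmetric_part le x y} &
      {in X0 X le & Xplus X le, forall x xp, strict_part le x xp} /\
      {in X & X & Xplus X le, forall (x y xp : E) (q r : rat),
         0 < q -> 0 < r ->
         strict_part le x (ratr q *: xp) ->
         strict_part le y (ratr r *: xp) ->
         strict_part le (x + y) (ratr (q + r) *: xp)}].
Proof.
move=> cone pre [z z0] [p0 p0_plus] Xminus0; split.
  move=> [u [u_ge0 u_sub u_cont u_op]].
  have [uZ uD] := u_sub.
  have XZ x (t : R) : X x -> 0 < t -> X (t *: x) by exact: cone_scale.
  have ler_u x y : X x -> X y -> le x y = (u x <= u y).
    exact: order_preserving_ler.
  have ltr_u x y : X x -> X y -> strict_part le x y = (u x < u y).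
    exact: order_preserving_ltr.
  have u_scale x (t : R) : X x -> 0 < t -> u (t *: x) = t * u x.
    by move=> Xx; exact: uZ _ (mem_set Xx) t.
  have u_X0 x : X0 X le x -> u x = 0.
    move=> [Xx [t [t0 t1 /andP[]]]]; rewrite !ler_u ?u_scale//; try exact: XZ.
    (* Equivalence of [x] and [t *: x] gives (1 - t) u x = 0, where t differs from 1. *)
    move=> ? ?; have : u x == t * u x by apply/eqP/le_anti/andP.
    rewrite -{1}[u x]mul1r -subr_eq0 -mulrBl mulf_eq0 subr_eq0 eq_sym.
    by rewrite (negbTE t1) => /eqP.
  (* For t > 1 the difference u (t x) - u x = (t - 1) u x has the sign of u x; conversely the factor
     2 is a witness. *)
  have u_Xplus x : Xplus X le x <-> X x /\ 0 < u x.
    split=> [[Xx [t [t1 xt]]]|[Xx ux]]; split=> //.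
      have t0 : 0 < t := lt_trans ltr01 t1.
      move: xt; rewrite ltr_u ?u_scale//; last exact: XZ.
      by rewrite -subr_gt0 -{2}[u x]mul1r -mulrBl pmulr_rgt0// subr_gt0.
    exists 2%:R; rewrite ltr1n ltr_u//; last exact: XZ.
    by rewrite u_scale// ltr_pMl// ltr1n.
  split.
  - move=> x y /set_mem Xx /set_mem Xy t t0.
    by rewrite !ler_u ?u_scale ?ler_pM2l//; exact: XZ.
  - exact: order_preserving_continuous_preorder u_cont.
  - move=> p /set_mem/u_Xplus[Xp up]; split.
      move=> _ [q q0 <-]; apply/u_Xplus; rewrite u_scale ?ltr0q//.
      by split; [apply: XZ; rewrite ?ltr0q|rewrite mulr_gt0 ?ltr0q].
    move=> x y /set_mem/u_Xplus[Xx ux] /set_mem/u_Xplus[Xy uy].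
    rewrite ltr_u// => xy.
    (* Dividing by u p turns the search for a multiple of [p] between [x] and [y] into density of
       the rationals in the reals. *)
    have /rat_in_itvoo[q] : u x / u p < u y / u p by rewrite ltr_pM2r ?invr_gt0.
    rewrite in_itv/= ltr_pdivrMr// ltr_pdivlMr// => /andP[xq qy].
    have q0 : 0 < ratr q :> R by rewrite -(pmulr_lgt0 _ up) (lt_trans ux).
    have Xqp := XZ _ _ Xp q0.
    exists (ratr q *: p); split; first by exists q => //=; rewrite -(ltr0q R).
      by rewrite ltr_u// u_scale.
    by rewrite ltr_u// u_scale.
  - move=> x y /set_mem x0 /set_mem y0; rewrite /symmetric_part.
    have [[Xx _] [Xy _]] := (x0, y0).
    by rewrite !ler_u ?u_X0 ?lexx.
  split.
    move=> x p /set_mem x0 /set_mem/u_Xplus[Xp up].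
    by rewrite ltr_u ?(u_X0 x)//; case: x0.
  move=> x y p /set_mem Xx /set_mem Xy /set_mem/u_Xplus[Xp up] q r.
  rewrite -(ltr0q R) -(ltr0q R r) => q0 r0; have qr0 := addr_gt0 q0 r0.
  rewrite rmorphD /= !ltr_u ?u_scale ?mulrDl//; try exact: XZ.
    move=> xq yr; apply: le_lt_trans (ltrD xq yr).
    exact: uD _ _ (mem_set Xx) (mem_set Xy).
  exact: cone_add.
move=> [homo le_cont dense X0_sim [X0_Xplus add_lt]].
(* For the converse, any element of X+ can be the base point of the gauge, since the density
   condition holds for each of them. *)
have pp := mem_set p0_plus; have dense_p := dense _ pp.
have ge0 : {in X, forall x, 0 <= gauge le p0 x}.
  move=> x /set_mem.
  exact: (gauge_ge0 cone pre homo Xminus0 X0_Xplus p0_plus dense_p).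
have sub : sublinear_on X (gauge le p0).
  split=> [x /set_mem Xx t|x y /set_mem Xx /set_mem Xy].
    exact: (gauge_scale cone pre homo Xminus0 X0_Xplus p0_plus dense_p).
  apply: (gauge_subadditive cone pre homo Xminus0 X0_Xplus
    p0_plus dense_p) => // q r q0 r0.
  by apply: add_lt => //; exact: mem_set.
have op : order_preserving_on X le (gauge le p0)
  by exact: (gauge_order_preserving cone pre homo Xminus0 X0_Xplus
    p0_plus dense_p).
exists (gauge le p0); split => //.
apply: (@order_preserving_continuous _ _ X le _ z p0) => //.
- exact: z0.1.
- exact: (gauge_X0 cone pre homo Xminus0 X0_Xplus p0_plus dense_p).
- exact: p0_plus.1.
- exact: (gauge_gt0 cone pre homo Xminus0 X0_Xplus p0_plus dense_p).
Qed.
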